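(* Let $n\ge 1$, and let $f\in C^1(\mathbb R^n)$ be a real-valued function that is not identically zero and has compact support. Let $G_f=\{\nabla f(x):x\in\mathbb R^n\}\subset\mathbb R^n$ be its gradient range. Then $$G_f=\overline{\operatorname{int} G_f}.$$
   Context: The interior and closure of subsets of $\mathbb R^n$ are taken in the Euclidean topology. The support of $f$ is $\operatorname{supp} f=\overline{\{x:f(x)\ne 0\}}$. *)

(* Defs.v *)
From HB Require Import structures.
From mathcomp Require Import all_boot all_order all_algebra.
From mathcomp Require Import all_classical all_reals all_analysis.
Set Implicit Arguments.
Unset Strict Implicit.
Unset Printing Implicit Defensive.
Import Order.TTheory GRing.Theory Num.Theory.
Import numFieldNormedType.Exports.
Local Open Scope classical_set_scope.
Local Open Scope ring_scope.

(* R^n is 'rV[R]_n. The library norms it by the max norm, which induces the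
   Euclidean topology. *)

Definition partial (R : realType) (n : nat) (f : 'rV[R]_n -> R) (i : 'I_n)
  (x : 'rV[R]_n) : R := 'D_(delta_mx 0 i) f x.

(* The existence clause is needed: 'D_v f x is a junk value where f is not
   derivable. *)
Definition C1 (R : realType) (n : nat) (f : 'rV[R]_n -> R) : Prop :=
  forall i : 'I_n,
    (forall x, derivable f x (delta_mx 0 i)) /\ continuous (partial f i).

Definition grad (R : realType) (n : nat) (f : 'rV[R]_n -> R)
  (x : 'rV[R]_n) : 'rV[R]_n := \row_i partial f i x.

Definition supp (R : realType) (n : nat) (f : 'rV[R]_n -> R)
  : set 'rV[R]_n := closure [set x | f x != 0].

Definition grad_range (R : realType) (n : nat) (f : 'rV[R]_n -> R)
  : set 'rV[R]_n := range (grad f).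

(* Main.v *)
Require Import Defs.
From HB Require Import structures.
From mathcomp Require Import all_boot all_order all_algebra.
From mathcomp Require Import all_classical all_reals all_analysis.
From mathcomp Require Import lra ring zify.
Set Implicit Arguments.
Unset Strict Implicit.
Unset Printing Implicit Defensive.
Import Order.TTheory GRing.Theory Num.Theory.
Import numFieldNormedType.Exports.
Local Open Scope classical_set_scope.
Local Open Scope ring_scope.

(** Let [G] be the gradient range. It is compact, hence closed, and contains a
    neighbourhood of [0]: for small [q], the extremum of [f - dot q] on a large
    ball is interior ([grad_range_nbhs0]). It remains to see that a gradient [p
    = grad f x0 != 0] is a limit of interior points of [G].

    Suppose not. Then the slopes [q] outside [G] are dense in a small cube
    around [p]. Put [tilt q x = f x - f x0 - dot q (x - x0)], which vanishes at
    [x0] and whose critical points are the points with gradient [q]. For [q]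
    outside [G] there is none, and [tilt q] is affine outside a ball; so all
    points of a bounded region can be moved downhill, continuously, until [tilt
    q <= -1] ([flow]). The region is the same for all these [q].

    Consider the map [Y0 q = x0 + (rho / r) (q - p)] on the cube [`|q - p| <=
    r]. Since [f] is differentiable at [x0], [tilt q (Y0 q)] is close to [-
    (rho / r) |q - p|^2]; it is negative except near the centre. Near the
    centre it is made negative as follows. Choose a fine grid and, close to
    each node, a slope outside [G]; then apply successively to [Y0 q] the
    downhill motions of these slopes, the [k]-th one for a time depending
    continuously on [q], equal to [1] if [q] is close to the [k]-th node and to
    [0] if it is not. A motion for the slope [qk] does not increase [tilt qk],
    so it increases [tilt q] at most by a constant times [`|q - qk|], that is,
    times the mesh. At most [4 ^ n] motions are active at a given [q], so the
    total loss is negligible when the mesh is small ([tilt_run], [count_bump]),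
    while one of them has brought the tilt down to [-1].

    The result is a continuous map [Y] with [tilt q (Y q) < 0] on the whole
    cube, hence [Y q != x0], that coincides with the affine map [Y0] on the
    boundary. This contradicts the no-retraction theorem
    ([exists_zero_of_id_outside_ball]), which is deduced by compactness from a
    cubical form of Sperner's lemma ([box_cup_eq1]). The latter is proved by
    computing a cup product of mod 2 coboundaries on a box of lattice points.
    *)

(** * Max norm, dot product and continuity *)

Lemma continuous_distP (R : realType) (V W : normedModType R) (u : V -> W)
    (x : V) :
  {for x, continuous u} <->
  (forall e, 0 < e -> exists2 d, 0 < d &
     forall y, `|y - x| <= d -> `|u y - u x| <= e).
Proof.
split=> [/cvgrPdist_le H e e0|H].
  have /nbhs_ballP[d /= d0 Hd] := H e e0.
  exists (d / 2); first by rewrite divr_gt0.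
  move=> y yx; rewrite distrC; apply: Hd; rewrite -ball_normE /= distrC.
  by apply: le_lt_trans yx _; rewrite ltr_pdivrMr // ltr_pMr // ltr1n.
apply/cvgrPdist_le => e e0; have [d d0 Hd] := H e e0.
apply: filterS (nbhsx_ballx x _ d0) => y; rewrite -ball_normE /= => /ltW yx.
by rewrite distrC; apply: Hd; rewrite distrC.
Qed.

Lemma coord_le_norm (R : realType) (n : nat) (v : 'rV[R]_n) (i : 'I_n) :
  `|v 0 i| <= `|v|.
Proof.
rewrite [leRHS]/Num.Def.normr /= mx_normrE; apply/bigmax_geP; right => /=.
by exists (0, i).
Qed.

Lemma norm_le_coord (R : realType) (n : nat) (v : 'rV[R]_n) (e : R) :
  0 <= e -> (forall i, `|v 0 i| <= e) -> `|v| <= e.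
Proof.
move=> e0 H; rewrite [leLHS]/Num.Def.normr /= mx_normrE.
by apply/bigmax_leP; split=> // -[j i] _ /=; rewrite ord1.
Qed.

Lemma continuous_affine (R : realType) (V : normedModType R) (a : R) (b : V) :
  continuous (fun x => b + a *: x).
Proof.
move=> x.
have cb : {for x, continuous (fun _ : V => b)} by exact: cst_continuous.
have ca : {for x, continuous (fun _ : V => a)} by exact: cst_continuous.
exact: (cvgD cb (cvgZ ca cvg_id)).
Qed.

Lemma continuous_row (R : realType) (n : nat) (T : topologicalType)
    (F : T -> 'rV[R]_n) (x : T) :
  (forall i, {for x, continuous (fun y => F y 0 i)}) ->
  {for x, continuous F}.
Proof.
move=> H; apply/cvgrPdist_le => e e0.
have : \forall y \near x, forall i, `|F x 0 i - F y 0 i| <= e.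
  apply: filter_forall => i.
  by move/cvgrPdist_le : (H i); apply.
apply: filterS => y Hy; apply: norm_le_coord; first exact: ltW.
by move=> i; rewrite !mxE.
Qed.

Definition clamp01 (R : realType) (t : R) : R := Num.min 1 (Num.max 0 t).

Section Clamp.
Variable R : realType.
Implicit Type t : R.

Lemma clamp01_itv t : 0 <= clamp01 t <= 1.
Proof. by rewrite le_min ler01 le_max lexx ge_min lexx. Qed.

Lemma clamp01_eq1 t : 1 <= t -> clamp01 t = 1.
Proof. by move=> t1; apply/min_idPl; rewrite le_max t1 orbT. Qed.

Lemma clamp01_eq0 t : t <= 0 -> clamp01 t = 0.
Proof. by move=> t0; rewrite /clamp01 (max_idPl t0); apply/min_idPr. Qed.

Lemma clamp01_le t : 0 <= t -> clamp01 t <= t.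
Proof. by move=> t0; rewrite ge_min ge_max t0 lexx orbT. Qed.

Lemma continuous_clamp01 (T : topologicalType) (u : T -> R) (x : T) :
  {for x, continuous u} -> {for x, continuous (fun y => clamp01 (u y))}.
Proof.
move=> cu; have cc (a : R) : {for x, continuous (fun _ : T => a)}.
  exact: cst_continuous.
exact: (continuous_min (cc 1) (continuous_max (cc 0) cu)).
Qed.

End Clamp.

Definition dot (R : realType) (n : nat) (u v : 'rV[R]_n) : R :=
  \sum_i u 0 i * v 0 i.

Section Dot.
Variables (R : realType) (n : nat).
Implicit Types u v w : 'rV[R]_n.

Lemma dotC u v : dot u v = dot v u.
Proof. by apply: eq_bigr => i _; rewrite mulrC. Qed.

Lemma dotDr u v w : dot u (v + w) = dot u v + dot u w.
Proof. by rewrite -big_split; apply: eq_bigr => i _; rewrite mxE mulrDr. Qed.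

Lemma dotZr (a : R) u v : dot u (a *: v) = a * dot u v.
Proof.
by rewrite /dot mulr_sumr; apply: eq_bigr => i _; rewrite mxE mulrCA.
Qed.

Lemma dot0r u : dot u 0 = 0.
Proof. by rewrite -(scale0r u) dotZr mul0r. Qed.

Lemma dotNr u v : dot u (- v) = - dot u v.
Proof. by rewrite -scaleN1r dotZr mulN1r. Qed.

Lemma dotBr u v w : dot u (v - w) = dot u v - dot u w.
Proof. by rewrite dotDr dotNr. Qed.

Lemma dotDl u v w : dot (v + w) u = dot v u + dot w u.
Proof. by rewrite !(dotC _ u) dotDr. Qed.

Lemma dotBl u v w : dot (v - w) u = dot v u - dot w u.
Proof. by rewrite !(dotC _ u) dotBr. Qed.

Lemma ler_norm_dot u v : `|dot u v| <= n%:R * (`|u| * `|v|).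
Proof.
apply: le_trans (ler_norm_sum _ _ _) _.
apply: le_trans (_ : \sum_(i < n) `|u| * `|v| <= _).
  by apply: ler_sum => i _; rewrite normrM ler_pM // coord_le_norm.
by rewrite sumr_const card_ord mulr_natl.
Qed.

Lemma dot_ge v : `|v| ^+ 2 <= dot v v.
Proof.
have D0 : 0 <= dot v v by apply: sumr_ge0 => i _; rewrite -expr2 sqr_ge0.
rewrite -(sqr_sqrtr D0) lerXn2r ?nnegrE ?sqrtr_ge0 //.
apply: norm_le_coord; first exact: sqrtr_ge0.
move=> i; rewrite -sqrtr_sqr ler_sqrt // /dot (bigD1 i) //= -expr2 lerDl.
by apply: sumr_ge0 => j _; rewrite -expr2 sqr_ge0.
Qed.

Lemma continuous_dot (T : topologicalType) u (F : T -> 'rV[R]_n) (x : T) :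
  {for x, continuous F} -> {for x, continuous (fun y => dot u (F y))}.
Proof.
move=> HF; apply: cvg_big => [|i _]; first exact: add_continuous.
 apply: cvgM; first exact: cvg_cst.
exact: (cvg_comp F (fun M : 'rV[R]_n => M 0 i) HF
  (@coord_continuous R 1 n 0 i (F x))).
Qed.

End Dot.

Lemma compact_uniform_continuity (R : realType) (n m : nat)
    (u : 'rV[R]_n -> 'rV[R]_m) (A : set 'rV[R]_n) (e : R) :
  continuous u -> compact A -> 0 < e ->
  exists2 d : R, 0 < d &
    forall x y, A x -> `|x - y| <= d -> `|u x - u y| <= e.
Proof.
move=> cu /compact_near_coveringP cA e0.
have : \forall d \near 0^'+, A `<=`
    (fun x => forall y, `|x - y| <= d -> `|u x - u y| <= e).
  apply: (cA _ (0^'+)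
    (fun d x => forall y, `|x - y| <= d -> `|u x - u y| <= e)).
  move=> x _.
  have /cvgrPdist_le/(_ (e / 2)) := cu x.
  rewrite divr_gt0 // => /(_ isT)/nbhs_ballP[d /= d0 Hd].
  exists (ball x (d / 2), [set t | t < d / 2]); first split => /=.
  - by apply: nbhsx_ballx; rewrite divr_gt0.
  - by apply: nbhs_right_lt; rewrite divr_gt0.
  - move=> [x' t] /= []; rewrite -ball_normE /= => xx' td y x'y.
    rewrite (splitr e) -(subrK (u x) (u x')) -addrA.
    apply: le_trans (ler_normD _ _) _; apply: lerD.
      rewrite distrC; apply: Hd; rewrite -ball_normE /=.
      by apply: lt_trans xx' _; rewrite ltr_pdivrMr// ltr_pMr// ltr1n.
    apply: Hd; rewrite -ball_normE /= (splitr d) -(subrK x' x) -addrA.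
    apply: le_lt_trans (ler_normD _ _) _; apply: ltrD => //.
    exact: le_lt_trans td.
move=> H; have : \forall d \near 0^'+, 0 < d /\ A `<=`
    (fun x => forall y, `|x - y| <= d -> `|u x - u y| <= e).
  by near=> d; split; near: d => //; exact: nbhs_right_gt.
move/filter_ex => [d [d0 Hd]]; exists d => // x y Ax.
exact: Hd.
Unshelve. all: by end_near.
Qed.

(** * Functions of class C^1 *)

Section C1Functions.
Variables (R : realType) (n : nat) (f : 'rV[R]_n -> R).
Hypothesis f_C1 : C1 f.

Lemma continuous_grad : continuous (grad f).
Proof.
move=> x; apply: continuous_row => i.
have -> : (fun y => grad f y 0 i) = partial f i.
  by apply/funext => y; rewrite mxE.
exact: (f_C1 i).2.
Qed.

Lemma is_derive_line (z : 'rV[R]_n) (i : 'I_n) (t : R) :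
  is_derive t 1 (fun s => f (z + s *: delta_mx 0 i))
    (partial f i (z + t *: delta_mx 0 i)).
Proof.
have [/(_ (z + t *: delta_mx 0 i)) df _] := f_C1 i.
have E : (fun h : R => h^-1 *: (((fun s => f (z + s *: delta_mx 0 i)) \o
     shift t) (h *: 1) - f (z + t *: delta_mx 0 i))) =
   (fun h : R => h^-1 *: ((f \o shift (z + t *: delta_mx 0 i))
      (h *: delta_mx 0 i) - f (z + t *: delta_mx 0 i))).
  apply/funext => h /=; rewrite [h *: 1]mulr1 scalerDl addrCA.
  by [].
by split; rewrite /derivable /derive ?E.
Qed.

(** The two orders of the endpoints are separate instances of the mean value
    theorem; stating the bound on [c] by absolute values lets later proofs
    ignore the sign of the increment. *)
Lemma line_mean_value (z : 'rV[R]_n) (i : 'I_n) (s : R) :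
  exists2 c : R, `|c| <= `|s| &
    f (z + s *: delta_mx 0 i) - f z = partial f i (z + c *: delta_mx 0 i) * s.
Proof.
set g := fun t : R => f (z + t *: delta_mx 0 i).
have dg (t : R) : is_derive t (1 : R) g (partial f i (z + t *: delta_mx 0 i)).
  exact: is_derive_line.
have cg : continuous g.
  move=> t; apply: differentiable_continuous; apply/derivable1_diffP.
  exact: ex_derive.
have g0 : g 0 = f z by rewrite /g scale0r addr0.
have [s0|/ltW s0] := leP 0 s.
  have [c] := @MVT_segment R g _ 0 s s0 (fun t _ => dg t)
    (continuous_subspaceT cg).
  rewrite in_itv /= g0 subr0 => /andP[c0 cs] E.
  by exists c => //; rewrite !ger0_norm.
have [c] := @MVT_segment R g _ s 0 s0 (fun t _ => dg t)
    (continuous_subspaceT cg).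
rewrite in_itv /= g0 sub0r => /andP[c0 cs] E.
exists c; first by rewrite !ler0_norm // lerN2.
by rewrite -[LHS]opprB E mulrN opprK.
Qed.

(** Going from [x] to [x + v] one coordinate at a time, each leg is an
    increment of [f] along an axis, to which the mean value theorem applies at
    a point that stays within [`|v|] of [x]. This quantitative form serves both
    as differentiability at a point ([w] the gradient there) and, with uniform
    continuity of the gradient, as a descent estimate uniform in [x]. *)
Lemma C1_linear_approx (x v w : 'rV[R]_n) (e : R) :
  (forall z, `|z - x| <= `|v| -> `|grad f z - w| <= e) ->
  `|f (x + v) - f x - dot w v| <= n%:R * (e * `|v|).
Proof.
move=> H.
(* [tr k] keeps the first [k] coordinates of [v]. *)
pose tr k : 'rV[R]_n := \row_j (if (j < k)%N then v 0 j else 0).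
have trS (k : 'I_n) : tr k.+1 = tr k + v 0 k *: delta_mx 0 k.
  apply/rowP => j; rewrite !mxE /= ltnS.
  have [->|jk] := eqVneq j k; first by rewrite leqnn ltnn add0r mulr1.
  by rewrite mulr0 addr0 leq_eqVlt (inj_eq val_inj) (negbTE jk).
have tr0 : tr 0%N = 0 by apply/rowP => j; rewrite !mxE.
have trn : tr n = v by apply/rowP => j; rewrite !mxE ltn_ord.
have -> : f (x + v) - f x =
    \sum_(k < n) (f (x + tr k.+1) - f (x + tr k)).
  by rewrite -(big_mkord xpredT (fun k => f (x + tr k.+1) - f (x + tr k)))
    telescope_sumr // tr0 trn addr0.
rewrite /dot -sumrB; apply: le_trans (ler_norm_sum _ _ _) _.
apply: le_trans (_ : \sum_(k < n) e * `|v| <= _); last first.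
  by rewrite sumr_const card_ord mulr_natl.
apply: ler_sum => k _; rewrite trS addrA.
have [c cs ->] := line_mean_value (x + tr k) k (v 0 k).
rewrite -mulrBl normrM ler_pM // ?coord_le_norm //.
set z := x + _ + _; have := H z.
have -> : partial f k z - w 0 k = (grad f z - w) 0 k by rewrite !mxE.
move=> Hz; apply: le_trans (coord_le_norm _ _) _; apply: Hz.
have -> : z - x = tr k + c *: delta_mx 0 k.
  by rewrite /z -(addrA x) [LHS]addrC addKr.
apply: norm_le_coord => // j.
rewrite !mxE /=; have [->|jk] := eqVneq j k.
  by rewrite ltnn add0r mulr1; apply: le_trans cs _; exact: coord_le_norm.
rewrite mulr0 addr0; case: ifP => _; first exact: coord_le_norm.
by rewrite normr0.
Qed.

Lemma C1_continuous : continuous f.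
Proof.
move=> x; apply/continuous_distP => e e0.
have [d d0 Hd] := (continuous_distP _ _).1 (continuous_grad (x := x)) 1 ltr01.
set L := n%:R * (`|grad f x| + 1).
have L0 : 0 <= L by rewrite mulr_ge0 // addr_ge0.
have L1 : 0 < L + 1 by rewrite ltr_wpDl.
exists (Num.min d (e / (L + 1))); first by rewrite lt_min d0 divr_gt0.
move=> y; rewrite le_min => /andP[yd ye].
have := @C1_linear_approx x (y - x) (grad f x) 1.
rewrite (addrC x (y - x)) subrK mul1r => H.
have {}H : `|f y - f x - dot (grad f x) (y - x)| <= n%:R * `|y - x|.
  by apply: H => z zx; apply: Hd; exact: le_trans yd.
rewrite -(subrK (dot (grad f x) (y - x)) (_ - _)).
apply: le_trans (ler_normD _ _) _.
apply: le_trans (_ : L * `|y - x| <= _).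
  rewrite /L mulrDr mulr1 mulrDl addrC lerD //.
  by rewrite -mulrA ler_norm_dot.
apply: le_trans (_ : (L + 1) * (e / (L + 1)) <= _).
  by rewrite ler_pM // lerDl.
by rewrite mulrCA divff ?gt_eqF // mulr1.
Qed.

End C1Functions.

(** * A mod 2 cup product on the integer lattice *)

Section CupProduct.
Variable n : nat.
Implicit Types (i j : 'I_n) (I : {set 'I_n}) (x y z : 'I_n -> nat).
Implicit Types (l u : ('I_n -> nat) -> 'F_2) (ls : seq (('I_n -> nat) -> 'F_2)).

Definition upd x i a : 'I_n -> nat := fun j => if j == i then a else x j.

Definition step i x := upd x i (x i).+1.

(** Values lie in the field with two elements, so that sums replace differences
    and no orientation signs are needed. *)
Definition diff i u x : 'F_2 := u (step i x) + u x.

(** The cup product of the coboundaries of the functions in [ls], evaluated on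
    the unit cube at [x] spanned by the directions in [I]. When [ls] has as
    many members as [I], it is the sum, over the monotone lattice paths from
    [x] to the opposite corner, of the product of the increments of the
    successive functions along the successive edges. *)
Fixpoint cup ls I x : 'F_2 :=
  if ls is l :: ls' then
    \sum_(i in I) diff i l x * cup ls' (I :\ i) (step i x)
  else 1.

Lemma addFF (a : 'F_2) : a + a = 0.
Proof. by apply: addrr_pchar2; rewrite pchar_Fp. Qed.

Lemma upd_comm x i j a b : i != j -> upd (upd x i a) j b = upd (upd x j b) i a.
Proof.
move=> ij; apply/funext => k; rewrite /upd.
by case: eqVneq => // ->; rewrite eq_sym (negbTE ij).
Qed.

Lemma upd_upd x i a b : upd (upd x i a) i b = upd x i b.
Proof. by apply/funext => k; rewrite /upd; case: eqVneq. Qed.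

Lemma upd_eq x i a : upd x i a i = a.
Proof. by rewrite /upd eqxx. Qed.

Lemma upd_neq x i j a : j != i -> upd x i a j = x j.
Proof. by rewrite /upd => /negbTE ->. Qed.

Lemma step_comm x i j : step i (step j x) = step j (step i x).
Proof.
have [->//|ij] := eqVneq i j.
by rewrite /step !upd_neq // 1?eq_sym // upd_comm // eq_sym.
Qed.

Lemma sum_offdiag_sym I (h : 'I_n -> 'I_n -> 'F_2) :
  (forall i j, h i j = h j i) -> \sum_(i in I) \sum_(j in I :\ i) h i j = 0.
Proof.
move=> hC.
have E i : \sum_(j in I :\ i) h i j =
    \sum_(j in I | (j < i)%N) h i j + \sum_(j in I | (i < j)%N) h i j.
  rewrite (bigID (fun j : 'I_n => (j < i)%N)) /=; congr (_ + _).
    apply: eq_bigl => j; rewrite !inE -(inj_eq val_inj) /=.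
    by case: ltngtP; rewrite ?andbT ?andbF.
  apply: eq_bigl => j; rewrite !inE -(inj_eq val_inj) /=.
  by case: ltngtP; rewrite ?andbT ?andbF.
rewrite (eq_bigr _ (fun i _ => E i)) big_split /=.
rewrite [X in _ + X](exchange_big_dep (mem I)) /=; last by move=> i j _ /andP[].
rewrite -[RHS](addFF (\sum_(i in I) \sum_(j in I | (j < i)%N) h i j)).
congr (_ + _); apply: eq_bigr => i iI.
by apply: eq_big => [j|j _]; [rewrite iI; case: (j \in I) | exact: hC].
Qed.

(** The Leibniz rule: when the cup product of [ls] is closed, multiplying it by
    the coboundary of [l] is the coboundary of [l] times it. *)
Lemma cup_leibniz l ls I x :
  \sum_(i in I) diff i (cup ls (I :\ i)) x = 0 ->
  cup (l :: ls) I x =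
    \sum_(i in I) diff i (fun y => l y * cup ls (I :\ i) y) x.
Proof.
move=> H; have {}H : \sum_(i in I) l x * diff i (cup ls (I :\ i)) x = 0.
  by rewrite -mulr_sumr H mulr0.
rewrite /= -[LHS]addr0 -[X in _ + X]H -big_split /=; apply: eq_bigr => i _.
rewrite /diff mulrDl mulrDr -addrA; congr (_ + _).
by rewrite addrA addFF add0r.
Qed.

(** By the Leibniz rule a cup product is a coboundary, and the coboundary of a
    coboundary pairs the directions [(i, j)] and [(j, i)], which cancel mod 2.
    *)
Lemma cup_closed ls I x : \sum_(i in I) diff i (cup ls (I :\ i)) x = 0.
Proof.
elim: ls I x => [|l ls IH] I x.
  by rewrite big1 // => i _; exact: addFF.
pose g i j y := l y * cup ls (I :\ i :\ j) y.
rewrite (eq_bigr (fun i => \sum_(j in I :\ i) diff i (diff j (g i j)) x)).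
  apply: sum_offdiag_sym => i j.
  have -> : g j i = g i j.
    by apply/funext => y; rewrite /g !finset.setDDl finset.setUC.
  by rewrite /diff step_comm addrACA.
move=> i _; rewrite {1}/diff !cup_leibniz // -big_split.
exact: eq_bigr.
Qed.

(** On the hyperplane [x i = a] the function [L i] is constant in the
    directions different from [i], so every product of increments has a zero
    factor. *)
Lemma cup_face_eq0 (L : 'I_n -> ('I_n -> nat) -> 'F_2) s I i (a : nat) x :
  i \notin I -> i \in s ->
  (forall j y, y i = a -> j != i -> diff j (L i) y = 0) ->
  x i = a -> cup [seq L k | k <- s] I x = 0.
Proof.
move=> iI + H; elim: s I x iI => // k s IH I x iI.
rewrite inE /= => /orP[/eqP <-|si] xa.
  rewrite big1 // => j jI; rewrite H ?mul0r //.
  by apply: contraNneq iI => <-.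
rewrite big1 // => j jI; have ji : i != j by apply: contraNneq iI => ->.
rewrite (IH (I :\ j)) ?mulr0 //; first by rewrite !inE negb_and iI orbT.
by rewrite /step upd_neq.
Qed.

(** A nonzero cup product has a path along which no factor vanishes, so every
    function changes its value near [x]. *)
Lemma cup_neq0 (L : 'I_n -> ('I_n -> nat) -> 'F_2) s I x k :
  cup [seq L i | i <- s] I x != 0 -> k \in s ->
  exists y z, L k y != L k z /\
   forall i, (x i <= y i <= x i + size s)%N && (x i <= z i <= x i + size s)%N.
Proof.
elim: s I x => //= k' s IH I x.
have stepP i j : (x j <= step i x j <= (x j).+1)%N.
  by rewrite /step /upd; case: eqVneq => [->|_]; rewrite ?leqnSn leqnn.
have [[i /andP[iI]]|no] := pselect (exists i, (i \in I) &&
    (diff i (L k') x * cup [seq L i | i <- s] (I :\ i) (step i x) != 0)).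
  rewrite mulf_eq0 negb_or => /andP[d0 c0] _; rewrite inE => /orP[/eqP ->|ks].
    exists (step i x), x; split=> [|j].
      by apply: contraNneq d0 => E; rewrite /diff E addFF.
    have /andP[-> s2] := stepP i j; rewrite leqnn leq_addr /= andbT.
    by apply: leq_trans s2 _; rewrite addnS ltnS leq_addr.
  have [y [z [yz H]]] := IH _ _ c0 ks.
  exists y, z; split=> // j; have /andP[s1 s2] := stepP i j.
  have /andP[/andP[y1 y2] /andP[z1 z2]] := H j.
  rewrite (leq_trans s1 y1) (leq_trans s1 z1) /= addnS -addSn.
  by rewrite (leq_trans y2) ?leq_add2r // (leq_trans z2) ?leq_add2r.
rewrite big1 ?eqxx // => i iI; apply/eqP/negP => /negP H.
by apply: no; exists i; rewrite iI.
Qed.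

Variable N : nat.

Definition slice_sum i u x : 'F_2 := \sum_(a < N) u (upd x i a).

Fixpoint box_sum (s : seq 'I_n) u : ('I_n -> nat) -> 'F_2 :=
  if s is i :: s' then slice_sum i (box_sum s' u) else u.

Lemma slice_diff i u x :
  slice_sum i (diff i u) x = u (upd x i N) + u (upd x i 0%N).
Proof.
rewrite /slice_sum; elim: N => [|m IH]; first by rewrite big_ord0 addFF.
rewrite big_ord_recr /= IH /diff /step upd_upd upd_eq.
by rewrite addrC addrA -(addrA _ _ (u (upd x i m))) addFF addr0.
Qed.

Lemma box_slice s i u : i \notin s ->
  slice_sum i (box_sum s u) = box_sum s (slice_sum i u).
Proof.
elim: s u => //= j s IH u; rewrite inE negb_or => /andP[ij si].
rewrite -IH //; apply/funext => x; rewrite /slice_sum exchange_big /=.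
by apply: eq_bigr => a _; apply: eq_bigr => b _; rewrite upd_comm.
Qed.

Lemma box_upd s i a u x : i \notin s ->
  box_sum s (fun y => u (upd y i a)) x = box_sum s u (upd x i a).
Proof.
elim: s x => //= j s IH x; rewrite inE negb_or => /andP[ij si].
by apply: eq_bigr => b _; rewrite IH // upd_comm // eq_sym.
Qed.

Lemma box_sum0 s x : box_sum s (fun=> 0) x = 0.
Proof.
by elim: s x => //= i s IH x; rewrite /slice_sum big1 // => a _; exact: IH.
Qed.

Lemma box_sum_eq0 s i u x : uniq s -> i \in s ->
  (forall y, slice_sum i u y = 0) -> box_sum s u x = 0.
Proof.
move=> + + H; elim: s x => //= j s IH x /andP[js us].
rewrite inE => /orP[/eqP E|si]; last first.
  by rewrite /slice_sum big1 // => a _; exact: IH.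
rewrite -E in js *; rewrite box_slice //.
by rewrite (_ : slice_sum i u = fun=> 0) ?box_sum0 //; apply/funext.
Qed.

Lemma box_sum_sum s (I : {set 'I_n}) (F : 'I_n -> ('I_n -> nat) -> 'F_2) x :
  box_sum s (fun y => \sum_(i in I) F i y) x = \sum_(i in I) box_sum s (F i) x.
Proof.
elim: s x => //= j s IH x; rewrite /slice_sum exchange_big /=.
by apply: eq_bigr => a _; exact: IH.
Qed.

Lemma box_sum_neq0 s u x : uniq s -> box_sum s u x != 0 ->
  exists y, [/\ u y != 0, forall i, i \in s -> (y i < N)%N &
    forall i, i \notin s -> y i = x i].
Proof.
elim: s x => [|i s IH] x /=; first by exists x.
move=> /andP[si us].
have [[a H] _|no] := pselect (exists a : 'I_N, box_sum s u (upd x i a) != 0).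
  have [y [y0 yN yx]] := IH _ us H; exists y; split=> // j.
    by rewrite inE => /orP[/eqP ->|/yN //]; rewrite yx // upd_eq.
  by rewrite inE negb_or => /andP[ji js]; rewrite yx // upd_neq.
rewrite /slice_sum big1 ?eqxx // => a _; apply/eqP/negP => /negP H.
by apply: no; exists a.
Qed.

(** The discrete form of the no-retraction theorem. By the Leibniz rule the sum
    over the box telescopes to its faces. The faces orthogonal to a direction
    [i] other than the first one do not contribute, because there the increments
    of [l i] vanish; on the two faces orthogonal to the first direction the
    first function is [0] and [1], which leaves the same sum in one dimension
    less. *)
Lemma box_cup_eq1 (l : 'I_n -> ('I_n -> nat) -> 'F_2) s x : uniq s ->
  (forall i y, y i = 0%N -> l i y = 0) -> (forall i y, y i = N -> l i y = 1) ->
  box_sum s (cup [seq l i | i <- s] [set i in s]) x = 1.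
Proof.
move=> + l0 l1; elim: s x => // m s IH x /andP[ms us].
set S := [set i in m :: s]; set ls := [seq l i | i <- s].
rewrite (_ : cup _ S = fun y => \sum_(i in S)
    diff i (fun z => l m z * cup ls (S :\ i) z) y); last first.
  by apply/funext => y; rewrite map_cons cup_leibniz // cup_closed.
rewrite box_sum_sum (bigD1 m) ?inE ?eqxx //= [X in _ + X]big1 ?addr0.
  have -> : S :\ m = [set i in s].
    apply/setP => i; rewrite !inE; have [->|//] := eqVneq i m.
    by rewrite (negbTE ms).
  rewrite box_slice // (_ : slice_sum m _ = fun y =>
     cup ls [set i in s] (upd y m N)); first by rewrite box_upd ?IH.
  apply/funext => y; rewrite slice_diff l1 ?upd_eq // l0 ?upd_eq //.
  by rewrite mul1r mul0r addr0.
move=> i /andP[iS im].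
have si : i \in s by move: iS; rewrite !inE (negbTE im).
(* The two faces orthogonal to a direction [i] of the tail contribute [0]. *)
apply: (@box_sum_eq0 (m :: s) i); rewrite /= ?ms ?inE ?si ?orbT // => y.
have iSi : i \notin S :\ i by rewrite !inE eqxx.
have sz j z : j != i -> step j z i = z i.
  by move=> ji; rewrite /step upd_neq // eq_sym.
have F0 : cup ls (S :\ i) (upd y i 0%N) = 0.
  apply: (cup_face_eq0 iSi si _ (upd_eq _ _ _)) => j z zi ji.
  by rewrite /diff !l0 ?sz ?addr0.
have FN : cup ls (S :\ i) (upd y i N) = 0.
  apply: (cup_face_eq0 iSi si _ (upd_eq _ _ _)) => j z zi ji.
  by rewrite /diff !l1 ?sz ?addFF.
by rewrite slice_diff F0 FN !mulr0 addr0.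
Qed.

End CupProduct.

(** * Zeros of maps that are the identity far away *)

Lemma compact_closed_norm_ball (R : realType) (n : nat) (r : R) :
  compact [set x : 'rV[R]_n | `|x| <= r].
Proof.
apply: bounded_closed_compact.
  exists r; split; first exact: num_real.
  by move=> M rM x /= xr; apply: ltW; exact: le_lt_trans rM.
rewrite (_ : [set x | _] =
  (fun x : 'rV[R]_n => `|x|) @^-1` [set t | t <= r]) //.
by apply: closed_comp => [x _|]; [exact: norm_continuous | exact: closed_le].
Qed.

(** Colour the points of a fine grid in the cube by the signs of the
    coordinates of [F]. On the boundary of the cube [F] is the identity, so the
    colours obey the boundary conditions of [box_cup_eq1], and some small cell
    sees both signs in every coordinate. If [F] had no zero, then by
    compactness [`|F|] would be bounded below and some coordinate would keep
    its sign on each sufficiently small cell. *)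
Lemma exists_zero_of_id_outside_ball (R : realType) (n : nat)
    (F : 'rV[R]_n -> 'rV[R]_n) :
  continuous F -> (forall s, 1 <= `|s| -> F s = s) -> exists s, F s = 0.
Proof.
move=> cF Fid; apply: contrapT => noz.
have Fn0 s : F s != 0 by apply/negP => /eqP Fs0; apply: noz; exists s.
pose A := [set x : 'rV[R]_n | `|x| <= 1].
have cA : compact A := @compact_closed_norm_ball R n 1.
have [m m0 Hm] : exists2 m : R, 0 < m & forall s, A s -> m <= `|F s|.
  have [||c _ Hc] := @EVT_min_rV R n (fun s => `|F s|) A _ cA.
  - by exists 0; rewrite /A /= normr0.
  - apply: continuous_subspaceT => x.
    by apply: (cvg_comp F); [exact: cF | exact: norm_continuous].
  - exists `|F c|; first by rewrite normr_gt0.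
    by move=> s As; apply: Hc; rewrite inE.
have e0 : 0 < m / 4 by rewrite divr_gt0.
have [d d0 Hd] := compact_uniform_continuity cF cA e0.
(* The cell reaches [n] grid steps of length [2 / N] in each coordinate. *)
set N := (Num.trunc (2 * n%:R / d)).+1.
have Nn : 2 * n%:R / N%:R <= d.
  rewrite ler_pdivrMr ?ltr0n // (mulrC d) -ler_pdivrMr // ltW //.
  exact: truncnS_gt.
pose pt (x : 'I_n -> nat) : 'rV[R]_n := \row_i (2 * (x i)%:R / N%:R - 1).
pose l i x : 'F_2 := (0 < F (pt x) 0 i)%R%:R.
have N0 : N%:R != 0 :> R by rewrite pnatr_eq0.
have l0 i x : x i = 0%N -> l i x = 0.
  move=> xi; have E : pt x 0 i = -1 by rewrite mxE xi mulr0 mul0r sub0r.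
  rewrite /l Fid ?E ?ltr0N1 //.
  by rewrite (le_trans _ (coord_le_norm _ i)) // E normrN1.
have l1 i x : x i = N -> l i x = 1.
  move=> xi; have E : pt x 0 i = 1.
    by rewrite mxE xi -mulrA divff // mulr1 -[2]/(1 + 1) addrK.
  rewrite /l Fid ?E ?ltr01 //.
  by rewrite (le_trans _ (coord_le_norm _ i)) // E normr1.
have := @box_cup_eq1 n N l (enum 'I_n) (fun=> 0%N) (enum_uniq _) l0 l1.
move=> B; have {}B : box_sum N (enum 'I_n) (cup [seq l i | i <- enum 'I_n]
   [set i in enum 'I_n]) (fun=> 0%N) != 0 by rewrite B oner_eq0.
have [x [cx xN _]] := box_sum_neq0 (enum_uniq _) B.
have Apt : A (pt x).
  apply: norm_le_coord => // i; rewrite mxE.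
  have Hx : 0 <= 2 * (x i)%:R / (N%:R : R) <= 2.
    apply/andP; split; first by rewrite divr_ge0 ?mulr_ge0.
    rewrite ler_pdivrMr ?ltr0n // ler_pM2l //.
    by rewrite ler_nat ltnW // xN // mem_enum.
  rewrite ler_norml; move: Hx => /andP[h1 h2].
  by rewrite lerBrDr addNr h1 /= lerBlDr.
have [i Fi] : exists i, m / 2 < `|F (pt x) 0 i|.
  apply: contrapT => no; have := Hm _ Apt; apply/negP; rewrite -ltNge.
  apply: le_lt_trans (_ : m / 2 < m); last first.
    by rewrite ltr_pdivrMr // ltr_pMr // ltr1n.
  apply: norm_le_coord => [|i]; first by rewrite divr_ge0 // ltW.
  by rewrite leNgt; apply/negP => H; apply: no; exists i.
have sgn (y : 'I_n -> nat) : (forall j, x j <= y j <= x j + n)%N ->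
    (0 < F (pt y) 0 i) = (0 < F (pt x) 0 i).
  move=> xy; have D : `|pt x - pt y| <= d.
    apply: le_trans Nn; apply: norm_le_coord => [|j].
      by rewrite divr_ge0 ?mulr_ge0.
    rewrite !mxE opprB addrA subrK -mulrBl -mulrBr normrM normfV normrM.
    rewrite !normr_nat ler_pM2r ?invr_gt0 ?ltr0n // ler_pM2l //.
    have /andP[y1 y2] := xy j.
    by rewrite distrC -natrB // normr_nat ler_nat leq_subLR.
  have := le_trans (coord_le_norm (F (pt x) - F (pt y)) i) (Hd _ _ Apt D).
  rewrite !mxE ler_norml => /andP[a1 a2].
  move: Fi; rewrite lter_normr.
  move: (F _ _ _) (F _ _ _) a1 a2 => a b a1 a2 /orP[] h.
    by apply/idP/idP => _; lra.
  by apply/idP/idP => ?; lra.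
have [y [z [yz H]]] := cup_neq0 cx (mem_enum _ i).
move: yz; rewrite size_enum_ord in H.
by rewrite /l !sgn ?eqxx // => j; have /andP[] := H j.
Qed.

(** * Gradients of compactly supported functions *)

Lemma bounded_of_vanish_far (R : realType) (n : nat) (u : 'rV[R]_n -> R)
    (r : R) :
  continuous u -> (forall x, r <= `|x| -> u x = 0) ->
  exists2 B, 0 <= B & forall x, u x <= B.
Proof.
move=> cu u0; have [A0|/nonemptyPn A0] :=
    pselect ([set x : 'rV[R]_n | `|x| <= r] !=set0).
  have [|c _ Hc] := EVT_max_rV A0 (@compact_closed_norm_ball R n r) (f := u).
    exact: continuous_subspaceT.
  exists `|u c| => // x; have [xr|/ltW rx] := leP `|x| r.
    by apply: le_trans (ler_norm _); apply: Hc; rewrite inE.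
  by rewrite u0.
exists 0 => // x; rewrite u0 //; apply: ltW; rewrite ltNge; apply/negP => xr.
by have : [set x : 'rV[R]_n | `|x| <= r] x by []; rewrite A0.
Qed.

Lemma vanish_far (R : realType) (n : nat) (f : 'rV[R]_n -> R) :
  compact (supp f) -> exists r0, forall r x, r0 <= r -> r <= `|x| ->
    f x = 0 /\ grad f x = 0.
Proof.
move=> /compact_bounded[M [_ HM]].
have f0 x : M + 1 < `|x| -> f x = 0.
  move=> Mx; apply: contrapT => /eqP fx.
  have : `|x| <= M + 1 by apply: HM; [rewrite ltrDl | exact: subset_closure].
  by rewrite leNgt Mx.
exists (M + 2) => r x Mr rx; have Mx : M + 1 < `|x|.
  by apply: lt_le_trans (le_trans Mr rx); rewrite ltrD2l ltr1n.
split; first exact: f0.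
apply/rowP => i; rewrite !mxE /partial.
rewrite (@near_eq_derive _ _ _ f (fun=> 0)) ?derive_cst //.
have e0 : 0 < `|x| - (M + 1) by rewrite subr_gt0.
apply: filterS (nbhsx_ballx x _ e0) => y; rewrite -ball_normE /= => xy.
by apply: f0; have := lerB_dist x y; lra.
Qed.

Section CompactlySupported.
Variables (R : realType) (n : nat) (f : 'rV[R]_n -> R) (r : R).
Hypotheses (n_gt0 : (0 < n)%N) (f_C1 : C1 f).
Hypothesis far : forall x, r <= `|x| -> f x = 0 /\ grad f x = 0.

Let far_val x : r <= `|x| -> f x = 0. Proof. by case/far. Qed.

Let far_grad x : r <= `|x| -> grad f x = 0. Proof. by case/far. Qed.

Lemma grad_uniform_continuity (e : R) : 0 < e -> exists2 d, 0 < d &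
  forall x y, `|x - y| <= d -> `|grad f x - grad f y| <= e.
Proof.
move=> e0; have [d d0 Hd] := compact_uniform_continuity
  (continuous_grad f_C1) (@compact_closed_norm_ball R n (r + 1)) e0.
exists (Num.min d 1); first by rewrite lt_min d0 ltr01.
move=> x y; rewrite le_min => /andP[xyd xy1].
have [xr|/ltW rx] := leP `|x| (r + 1); first exact: Hd.
have ry : r <= `|y| by have := lerB_dist x y; lra.
rewrite !far_grad ?subrr ?normr0 ?(ltW e0) //.
by apply: le_trans rx; rewrite lerDl.
Qed.

Lemma grad_bounded : exists2 B, 0 <= B & forall x, `|grad f x| <= B.
Proof.
apply: (@bounded_of_vanish_far R n (fun x => `|grad f x|) r) => [x|x rx].
  apply: (cvg_comp (grad f)); [exact: continuous_grad | exact: norm_continuous].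
by rewrite far_grad //; exact: normr0.
Qed.

Lemma C1_bounded : exists2 B, 0 <= B & forall x, `|f x| <= B.
Proof.
apply: (@bounded_of_vanish_far R n (fun x => `|f x|) r) => [x|x rx].
  apply: (cvg_comp f); [exact: C1_continuous | exact: norm_continuous].
by rewrite far_val //; exact: normr0.
Qed.

(** The gradient vanishes far away, and it also vanishes somewhere on a fixed
    sphere, so the range is the image of a compact ball. *)
Lemma closed_grad_range : closed (grad_range f).
Proof.
apply: compact_closed; first exact: norm_hausdorff.
rewrite (_ : grad_range f = grad f @` [set x | `|x| <= `|r|]); last first.
  apply/seteqP; split=> [_ [x _ <-]|_ [x _ <-]]; last by exists x.
  have [xr|/ltW rx] := leP `|x| `|r|; first by exists x.
  have cr : `|const_mx r : 'rV[R]_n| = `|r|.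
    apply/eqP; rewrite eq_le; apply/andP; split.
      by apply: norm_le_coord => // i; rewrite mxE.
    have := coord_le_norm (const_mx r : 'rV[R]_n) (Ordinal n_gt0).
    by rewrite mxE.
  exists (const_mx r) => /=; first by rewrite cr.
  rewrite !far_grad ?cr ?ler_norm //.
  by apply: le_trans rx; exact: ler_norm.
apply: continuous_compact; last exact: compact_closed_norm_ball.
exact/continuous_subspaceT/continuous_grad.
Qed.

(** A slope [q] outside the closed gradient range stays at a positive distance
    from all gradients. Hence one step length works at every point: moving
    along [q - grad f x] changes [f - dot q] by [- t] times the squared
    Euclidean length of [q - grad f x], up to half of that amount. Both signs
    of [t] are kept because the same estimate is used to go up and to go down.
    *)
Lemma step_estimate (q : 'rV[R]_n) : ~ grad_range f q ->
  exists h c A, [/\ 0 < h, 0 < c, 0 < A,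
    forall x, `|q - grad f x| <= A &
    forall x t, `|t| <= h ->
      2 * c <= dot (q - grad f x) (q - grad f x) /\
      `|f (x + t *: (q - grad f x)) - f x - t * dot q (q - grad f x) +
         t * dot (q - grad f x) (q - grad f x)| <= `|t| * c].
Proof.
move=> Gq.
have /nbhs_ballP[c0 /= c00 Hc0] : nbhs q (~` grad_range f).
  by apply: open_nbhs_nbhs; split=> //; rewrite openC; exact: closed_grad_range.
have [B B0 HB] := grad_bounded.
pose A := `|q| + B + 1; pose c := c0 ^+ 2 / 2.
have A0 : 0 < A by rewrite ltr_wpDl // addr_ge0.
have c1 : 0 < c by rewrite divr_gt0 // exprn_gt0.
have VA x : `|q - grad f x| <= A.
  apply: le_trans (ler_normB _ _) _; have := HB x; rewrite /A; lra.
have nA : 0 < n%:R * A by rewrite mulr_gt0 // ltr0n.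
have [d d0 Hd] := grad_uniform_continuity (divr_gt0 c1 nA).
exists (d / A), c, A; split=> // [|x t th]; first by rewrite divr_gt0.
set V := q - grad f x; split.
  apply: le_trans (dot_ge V); rewrite /c mulrC divfK //.
  rewrite ler_pXn2r ?nnegrE ?(ltW c00) // leNgt; apply/negP => Vc.
  by apply: (Hc0 (grad f x)); rewrite -?ball_normE //; exists x.
have tV : `|t *: V| <= `|t| * A by rewrite normrZ ler_wpM2l // VA.
have tVd : `|t *: V| <= d.
  by apply: le_trans tV _; rewrite -ler_pdivlMr.
have := @C1_linear_approx R n f f_C1 x (t *: V) (grad f x) (c / (n%:R * A)).
rewrite (_ : dot (grad f x) _ = t * dot q V - t * dot V V); last first.
  by rewrite dotZr -mulrBr -dotBl /V subKr.
rewrite opprB addrA addrAC => H; apply: le_trans (H _) _.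
  by move=> z zx; apply: Hd; apply: le_trans zx _.
apply: le_trans (_ : n%:R * (c / (n%:R * A) * (`|t| * A)) <= _).
  by rewrite ler_wpM2l // ler_wpM2l // ltW // divr_gt0.
rewrite le_eqVlt; apply/orP; left; apply/eqP; field.
by rewrite !gt_eqF // ltr0n.
Qed.

(** For a small slope [q], the function [f - dot q] (or its opposite, according
    to the sign [s] of [f x1]) attains its maximum over a large ball away from
    the boundary, since [f] vanishes there while [`|f x1|] dominates the linear
    term. If [q] were not a gradient, a small step would increase the value. *)
Lemma grad_range_nbhs0 (x1 : 'rV[R]_n) :
  f x1 != 0 -> nbhs (0 : 'rV[R]_n) (grad_range f).
Proof.
move=> fx1; have x1r : `|x1| < r.
  by rewrite ltNge; apply/negP => /far[fx _]; rewrite fx eqxx in fx1.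
have r0 : 0 < r by exact: le_lt_trans x1r.
pose s := Num.sg (f x1).
have ss : s * s = 1 by rewrite -expr2 sqr_sg fx1.
have d0 : 0 < `|f x1| / (n%:R * (2 * r)).
  by rewrite divr_gt0 ?normr_gt0 // !mulr_gt0 // ltr0n.
apply: filterS (nbhsx_ballx 0 _ d0) => q; rewrite -ball_normE /= sub0r normrN.
rewrite ltr_pdivlMr ?mulr_gt0 ?ltr0n // => qsmall; apply: contrapT => Gq.
pose g x := s * (f x - dot q (x - x1)).
have cg : continuous g.
  move=> x.
  have cd : {for x, continuous (fun y : 'rV[R]_n => dot q (y - x1))}.
    apply: continuous_dot; apply/continuous_distP => e e0.
    by exists e => // y; rewrite opprB addrA subrK.
  have cs : {for x, continuous (fun _ : 'rV[R]_n => s)}.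
    exact: cst_continuous.
  exact: (cvgM cs (cvgB (C1_continuous f_C1 (x := x)) cd)).
have [||m mr Hm] := @EVT_max_rV R n g _ _ (@compact_closed_norm_ball R n r).
- by exists x1; exact: ltW.
- exact: continuous_subspaceT.
have {}mr : `|m| <= r by rewrite inE in mr.
have gx1 : g x1 = `|f x1|.
  by rewrite /g subrr dot0r subr0 /s -normrEsg.
have gm : `|f x1| <= g m by rewrite -gx1; apply: Hm; rewrite inE /=; exact: ltW.
have mr' : `|m| < r.
  rewrite ltNge; apply/negP => rm; move: gm; apply/negP; rewrite -ltNge.
  rewrite /g (far_val rm) sub0r; apply: le_lt_trans (ler_norm _) _.
  rewrite normrM normrN normr_sg fx1 mul1r; apply: le_lt_trans qsmall.
  apply: le_trans (ler_norm_dot _ _) _; rewrite mulrCA ler_wpM2l //.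
  rewrite ler_wpM2l //; apply: le_trans (ler_normB _ _) _; lra.
have [h [c [A [h0 c0 A0 VA Hstep]]]] := step_estimate Gq.
pose t := Num.min h ((r - `|m|) / A).
have t0 : 0 < t by rewrite lt_min h0 divr_gt0 // subr_gt0.
have nt : `|- s * t| = t.
  by rewrite normrM normrN normr_sg fx1 mul1r gtr0_norm.
have th : `|- s * t| <= h by rewrite nt ge_min lexx.
have [V2 Hs] := Hstep m _ th; rewrite nt in Hs; set V := q - grad f m in V2 Hs.
have mV : `|m + (- s * t) *: V| <= r.
  apply: le_trans (ler_normD _ _) _; rewrite normrZ nt.
  apply: le_trans (_ : `|m| + t * A <= _).
    by rewrite lerD2l ler_wpM2l // ?VA // ltW.
  have : t <= (r - `|m|) / A by rewrite ge_min lexx orbT.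
  rewrite ler_pdivlMr //; lra.
have := Hm (m + (- s * t) *: V); rewrite inE => /(_ mV); apply/negP.
rewrite -ltNge /g -subr_gt0 -mulrBr.
rewrite (_ : m + _ - x1 = (m - x1) + (- s * t) *: V); last by rewrite addrAC.
rewrite dotDr dotZr.
set D := f _ - f m - _ + _ in Hs.
rewrite (_ : _ - (f m - _) = D - (- s * t) * dot V V); last by rewrite /D; ring.
rewrite mulrBr mulrA mulrA mulrN ss mulN1r mulNr opprK.
have : `|s * D| <= t * c by rewrite normrM normr_sg fx1 mul1r.
have tc : 0 < t * c by rewrite mulr_gt0.
have : t * (2 * c) <= t * dot V V by rewrite ler_wpM2l // ltW.
rewrite ler_norml => ? /andP[? _]; lra.
Qed.

End CompactlySupported.

(** * Downhill motion for a slope outside the gradient range *)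

(** A critical point of [tilt f x0 q] is a point where the gradient of [f] is
    [q]. The normalisation makes every [tilt f x0 q] vanish at [x0]. *)
Definition tilt (R : realType) (n : nat) (f : 'rV[R]_n -> R)
  (x0 q x : 'rV[R]_n) : R := f x - f x0 - dot q (x - x0).

Section Flow.
Variables (R : realType) (n : nat) (f : 'rV[R]_n -> R) (p x0 : 'rV[R]_n).
Variables (r s : R).
Hypotheses (n_gt0 : (0 < n)%N) (f_C1 : C1 f) (p_neq0 : p != 0).
Hypotheses (r_ge0 : 0 <= r) (r_small : 8 * n%:R * r * `|p| <= dot p p).
Hypotheses (s_ge0 : 0 <= s).
Hypothesis far : forall x, s <= `|x| -> f x = 0 /\ grad f x = 0.

Let far_val x : s <= `|x| -> f x = 0. Proof. by case/far. Qed.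

Let far_grad x : s <= `|x| -> grad f x = 0. Proof. by case/far. Qed.

Let np_gt0 : 0 < `|p|. Proof. by rewrite normr_gt0. Qed.

Let nR_gt0 : 0 < n%:R :> R. Proof. by rewrite ltr0n. Qed.

Let pp_gt0 : 0 < dot p p.
Proof. by apply: lt_le_trans (dot_ge p); rewrite exprn_gt0. Qed.

Let r_le : r <= `|p|.
Proof.
have H : n%:R * (8 * r) * `|p| <= n%:R * `|p| * `|p|.
  rewrite mulrCA !mulrA -(mulrA n%:R `|p|); apply: le_trans r_small _.
  by apply: le_trans (ler_norm _) _; exact: ler_norm_dot.
have : 8 * r <= `|p| by move: H; rewrite ler_pM2r // ler_pM2l.
by move: r_ge0; lra.
Qed.

(** The constants below define a bounded region that is stable under the
    downhill motions for all slopes [q] near [p]. Outside the support such a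
    motion is a translation by a multiple of [q], and all these [q] lie in the
    cone [`|x| <= slope * dot p x]; [offset] is chosen so that the translated
    cone contains the ball of radius [s + 1]. The motions stop at [dot p x =
    height + 1] at the latest, which makes the region bounded, and [height] is
    so large that [tilt f x0 q x <= -1] once [dot p x] reaches it. None of the
    constants depends on [q]. *)
Definition slope : R := 4 * `|p| / dot p p.

Definition offset : R := (s + 1) + slope * (n%:R * (`|p| * (s + 1))).

Definition height : R := n%:R * (`|p| * (s + 1)) +
  2 * (n%:R * r * offset + n%:R * (2 * `|p| * `|x0|) + `|f x0| + 1).

Definition region (x : 'rV[R]_n) : Prop :=
  `|x| <= offset + slope * dot p x /\ dot p x <= height + 1.

Definition radius : R := offset + slope * (height + 1).

Let slope_ge0 : 0 <= slope.
Proof. by rewrite /slope divr_ge0 ?mulr_ge0 // (ltW pp_gt0). Qed.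

Let offset_ge0 : 0 <= offset.
Proof.
by rewrite /offset addr_ge0 ?addr_ge0 // mulr_ge0 // !mulr_ge0 // addr_ge0.
Qed.

Let height_ge : n%:R * (`|p| * (s + 1)) + 1 <= height.
Proof.
have h : 0 <= n%:R * r * offset + n%:R * (2 * `|p| * `|x0|) + `|f x0|.
  by rewrite !addr_ge0 // !mulr_ge0.
by rewrite /height; lra.
Qed.

Let dot_p_near x (t : R) : `|x| <= t -> `|dot p x| <= n%:R * (`|p| * t).
Proof.
move=> xt; apply: le_trans (ler_norm_dot _ _) _.
by rewrite ler_wpM2l // ler_wpM2l.
Qed.

Lemma region_near x : `|x| <= s + 1 -> region x.
Proof.
move=> xs; have := dot_p_near xs; rewrite ler_norml => /andP[d1 d2].
split; last by move: height_ge; lra.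
apply: le_trans xs _; rewrite /offset -addrA lerDl -mulrDr mulr_ge0 //.
by move: d1; lra.
Qed.

Lemma region_bounded x : region x -> `|x| <= radius.
Proof.
by move=> [x1 x2]; apply: le_trans x1 _; rewrite lerD2l ler_wpM2l.
Qed.

Lemma cone q : `|q - p| <= r -> 0 < dot p q /\ `|q| <= slope * dot p q.
Proof.
move=> qr; have := dot_p_near qr; rewrite ler_norml dotBr => /andP[d1 _].
have d2 : dot p p <= 2 * dot p q.
  have : 8 * n%:R * r * `|p| = 8 * (n%:R * (`|p| * r)) by ring.
  have : 0 <= n%:R * (`|p| * r) by rewrite !mulr_ge0.
  by move: d1 r_small; lra.
split; first by move: pp_gt0; lra.
apply: le_trans (_ : 2 * `|p| <= _).
  have := lerB_dist q p; move: r_le qr; lra.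
rewrite /slope mulrAC ler_pdivlMr //.
by have := ler_wpM2l (ltW np_gt0) d2; lra.
Qed.

(** At this height the point is outside the support, so the tilt is affine in
    [x]. Replacing [dot q x] by [dot p x] costs at most [n * r * `|x|], of
    which the smallness of [r] lets half of [dot p x] absorb the part growing
    with [x]. *)
Lemma tilt_far q x : `|q - p| <= r -> region x -> height <= dot p x ->
  tilt f x0 q x <= -1.
Proof.
move=> qr [x1 _] hx.
have xs : s <= `|x|.
  have [//|/ltW xs] := leP s `|x|.
  have := dot_p_near xs; rewrite ler_norml => /andP[_ d2].
  have : n%:R * (`|p| * s) <= n%:R * (`|p| * (s + 1)).
    by rewrite ler_pM2l // ler_pM2l // lerDl.
  by move: height_ge; lra.
rewrite /tilt far_val // dotBr.
have dp0 : 0 <= dot p x.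
  apply: le_trans hx; apply: le_trans height_ge.
  by rewrite addr_ge0 // !mulr_ge0 // addr_ge0.
have A1 : `|dot (q - p) x| <= n%:R * r * offset + dot p x / 2.
  apply: le_trans (ler_norm_dot _ _) _.
  apply: le_trans (_ : n%:R * (r * (offset + slope * dot p x)) <= _).
    by rewrite ler_wpM2l // ler_pM.
  have nrM : n%:R * r * slope <= 1 / 2.
    by rewrite /slope mulrA ler_pdivrMr //; move: r_small; lra.
  by have := ler_wpM2r dp0 nrM; lra.
have A2 : `|dot q x0| <= n%:R * (2 * `|p| * `|x0|).
  apply: le_trans (ler_norm_dot _ _) _; rewrite ler_wpM2l // ler_wpM2r //.
  have := lerB_dist q p; move: r_le qr; lra.
move: A1; rewrite dotBl ler_norml => /andP[A1 _].
move: A2; rewrite ler_norml => /andP[_ A2].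
have := ler_norm (- f x0); rewrite normrN.
have : n%:R * (`|p| * (s + 1)) >= 0 by rewrite !mulr_ge0 // addr_ge0.
move: hx; rewrite /height; lra.
Qed.

(** Stopping gradually between the heights [height] and [height + 1] keeps the
    region stable and the motion continuous, while below [height] the steps
    keep their full length. *)
Definition brake (x : 'rV[R]_n) : R :=
  clamp01 (height + 1 - dot p x).

Definition euler (q : 'rV[R]_n) (h t : R) (x : 'rV[R]_n) : 'rV[R]_n :=
  x + (t * h * brake x) *: (q - grad f x).

Let brake_itv x : 0 <= brake x <= 1. Proof. exact: clamp01_itv. Qed.

Lemma continuous_brake : continuous brake.
Proof.
move=> x; apply: (@continuous_clamp01 R _ (fun y => height + 1 - dot p y)).
have cd : {for x, continuous (fun y : 'rV[R]_n => dot p y)}.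
  by apply: continuous_dot; exact: cvg_id.
have cc : {for x, continuous (fun _ : 'rV[R]_n => height + 1)}.
  exact: cst_continuous.
exact: (cvgB cc cd).
Qed.

Lemma continuous_euler (T : topologicalType) q h (eta : T -> R)
    (Y : T -> 'rV[R]_n) (u : T) :
  {for u, continuous eta} -> {for u, continuous Y} ->
  {for u, continuous (fun v => euler q h (eta v) (Y v))}.
Proof.
move=> ce cY.
have ch : {for u, continuous (fun _ : T => h)} by exact: cst_continuous.
have cq : {for u, continuous (fun _ : T => q)} by exact: cst_continuous.
have cb : {for u, continuous (fun v => brake (Y v))}.
  exact: (cvg_comp Y brake cY (@continuous_brake (Y u))).
have cg : {for u, continuous (fun v => grad f (Y v))}.
  exact: (cvg_comp Y (grad f) cY (continuous_grad f_C1 (x := Y u))).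
exact: (cvgD cY (cvgZ (cvgM (cvgM ce ch) cb) (cvgB cq cg))).
Qed.

(** Inside the support a short step stays in the ball of radius [s + 1], which
    lies in the region; outside the support a step adds a positive multiple of
    [q] and preserves the cone. The drop of the tilt comes from
    [step_estimate]. *)
Lemma euler_step q : `|q - p| <= r -> ~ grad_range f q ->
  exists h c, [/\ 0 < c,
    forall t x, 0 <= t <= 1 -> region x ->
      [/\ region (euler q h t x),
          tilt f x0 q (euler q h t x) <= tilt f x0 q x &
          height <= dot p x -> height <= dot p (euler q h t x)] &
    forall x, dot p x <= height ->
      tilt f x0 q (euler q h 1 x) <= tilt f x0 q x - c].
Proof.
move=> qr Gq; have [pq0 qpq] := cone qr.
have [h0 [c [A [h00 c0 A0 VA Hstep]]]] := step_estimate n_gt0 f_C1 far Gq.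
pose h := Num.min h0 (Num.min A^-1 (dot p q)^-1).
have h_gt0 : 0 < h by rewrite !lt_min h00 !invr_gt0 A0.
have hh0 : h <= h0 by rewrite ge_min lexx.
have hA : h * A <= 1.
  by rewrite -ler_pdivlMr // mul1r !ge_min lexx ?orbT.
have hpq : h * dot p q <= 1.
  by rewrite -ler_pdivlMr // mul1r !ge_min lexx ?orbT.
have descent tau x : 0 <= tau <= h ->
    tilt f x0 q (x + tau *: (q - grad f x)) <= tilt f x0 q x - tau * c.
  move=> /andP[t0 th].
  have [|V2 H] := Hstep x tau; first by rewrite ger0_norm // (le_trans th).
  rewrite /tilt (_ : x + _ - x0 = (x - x0) + tau *: (q - grad f x)).
    rewrite [dot q (_ + _)]dotDr dotZr.
    have : tau * (2 * c) <= tau * dot (q - grad f x) (q - grad f x).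
      by rewrite ler_wpM2l.
    by move: H; rewrite (ger0_norm t0) ler_norml => /andP[_]; lra.
  by rewrite addrAC.
have kb t x : 0 <= t <= 1 -> 0 <= t * h * brake x <= h * brake x.
  move=> /andP[t0 t1]; have /andP[b0 b1] := brake_itv x.
  rewrite !mulr_ge0 ?(ltW h_gt0) //= ler_wpM2r //.
  by rewrite -[leRHS]mul1r ler_wpM2r // ltW.
have kh t x : 0 <= t <= 1 -> 0 <= t * h * brake x <= h.
  move=> /(kb t x)/andP[-> H] /=; apply: le_trans H _.
  by rewrite -[leRHS]mulr1 ler_wpM2l ?(ltW h_gt0) //; case/andP: (brake_itv x).
exists h, (h * c); split=> [|t x t01 [x1 x2]|x xC].
- by rewrite mulr_gt0.
- have := descent _ x (kh _ x t01); have := kb _ x t01; have := kh _ x t01.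
  rewrite /euler; set tau := t * h * brake x => /andP[t0 th] /andP[_ tb] D.
  have D' : tilt f x0 q (x + tau *: (q - grad f x)) <= tilt f x0 q x.
    by apply: le_trans D _; rewrite gerDl oppr_le0 mulr_ge0 // ltW.
  have [xs|xs] := leP `|x| s.
    have N : `|x + tau *: (q - grad f x)| <= s + 1.
      apply: le_trans (ler_normD _ _) _; apply: lerD => //.
      rewrite normrZ ger0_norm //; apply: le_trans hA.
      by rewrite ler_pM // VA.
    split=> //; first exact: region_near.
    move=> hx; exfalso; move: hx; apply/negP; rewrite -ltNge.
    have : `|x| <= s + 1 by move: xs; lra.
    move=> /dot_p_near; rewrite ler_norml => /andP[_].
    by move: height_ge; lra.
  rewrite far_grad ?(ltW xs) // subr0.
  have tpq : 0 <= tau * dot p q by rewrite mulr_ge0 // ltW.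
  split; last by move=> hx; rewrite dotDr dotZr; move: hx tpq; lra.
    split; rewrite dotDr dotZr.
      rewrite mulrDr addrA; apply: le_trans (ler_normD _ _) _.
      apply: lerD => //.
      by rewrite normrZ ger0_norm // mulrCA ler_wpM2l.
    have b1 : brake x <= height + 1 - dot p x.
      by apply: clamp01_le; move: x2; lra.
    have : tau * dot p q <= brake x.
      apply: le_trans (_ : h * brake x * dot p q <= _).
        by rewrite ler_wpM2r // ltW.
      rewrite mulrAC -[leRHS]mul1r ler_wpM2r //.
      by case/andP: (brake_itv x).
    by move: b1; lra.
  by rewrite far_grad ?(ltW xs) // subr0 in D'.
- have b1 : brake x = 1.
    by apply: clamp01_eq1; move: xC; lra.
  rewrite /euler b1 mul1r mulr1; apply: descent.
  by rewrite lexx ltW.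
Qed.

(** The motion is a finite iteration of Euler steps, the time [t] scaling all
    step lengths at once. At time [1] each step below [height] lowers the tilt
    by a fixed amount; the tilt being bounded on the region, enough steps bring
    every point to [height], above which it then remains. *)
Lemma flow q : `|q - p| <= r -> ~ grad_range f q ->
  exists Psi : R -> 'rV[R]_n -> 'rV[R]_n, [/\
    forall x, Psi 0 x = x,
    forall (T : topologicalType) (eta : T -> R) (Y : T -> 'rV[R]_n) (u : T),
      {for u, continuous eta} -> {for u, continuous Y} ->
      {for u, continuous (fun v => Psi (eta v) (Y v))},
    forall t x, 0 <= t <= 1 -> region x ->
      region (Psi t x) /\ tilt f x0 q (Psi t x) <= tilt f x0 q x &
    forall x, region x -> height <= dot p (Psi 1 x)].
Proof.
move=> qr Gq; have [h [c [c0 step drop]]] := euler_step qr Gq.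
have [B B0 HB] := C1_bounded f_C1 far.
pose D := B + `|f x0| + n%:R * (`|q| * (radius + `|x0|)).
have tilt_le x : region x -> `|tilt f x0 q x| <= D.
  move=> rx; rewrite /tilt; apply: le_trans (ler_normB _ _) _; apply: lerD.
    by apply: le_trans (ler_normB _ _) _; rewrite lerD2r.
  apply: le_trans (ler_norm_dot _ _) _; rewrite ler_wpM2l // ler_wpM2l //.
  by apply: le_trans (ler_normB _ _) _; rewrite lerD2r region_bounded.
set m := (Num.trunc (2 * D / c)).+1.
have mc : 2 * D < m%:R * c by rewrite -ltr_pdivrMr // truncnS_gt.
have le01 : 0 <= (1 : R) <= 1 by rewrite ler01 lexx.
exists (fun t => iter m (euler q h t)); split.
- move=> x; elim: m {mc} => //= k ->.
  by rewrite /euler !mul0r scale0r addr0.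
- move=> T eta Y u ce cY; elim: m {mc} => //= k IH.
  exact: continuous_euler.
- move=> t x t01 rx; elim: m {mc} => [|k [IH1 IH2]] /=; first by split.
  by have [S1 S2 _] := step t _ t01 IH1; split=> //; exact: le_trans IH2.
move=> x rx.
have rk k : region (iter k (euler q h 1) x).
  by elim: k => //= k IH; have [] := step 1 _ le01 IH.
have H k : height <= dot p (iter k (euler q h 1) x) \/
    tilt f x0 q (iter k (euler q h 1) x) <= tilt f x0 q x - k%:R * c.
  elim: k => [|k IH] /=; first by right; rewrite mul0r subr0.
  set y := iter k (euler q h 1) x in IH *.
  have [hy|/ltW hy] := leP height (dot p y).
    by left; have [_ _] := step 1 y le01 (rk k); apply.
  case: IH => [hy'|IH]; last first.
    right; have := drop y hy; rewrite -natr1; lra.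
  by left; have [_ _] := step 1 y le01 (rk k); apply.
case: (H m) => // Hm.
have := tilt_le _ rx; have := tilt_le _ (rk m).
by rewrite !ler_norml => /andP[a1 _] /andP[_ a2]; lra.
Qed.

End Flow.

(** * Applying the downhill motions of a grid of slopes *)

Section Run.
Variables (R : realType) (n : nat) (f : 'rV[R]_n -> R) (x0 : 'rV[R]_n).
Variables (region : 'rV[R]_n -> Prop) (radius eps : R) (I : eqType).
Variable qs : I -> 'rV[R]_n.
Variables (eta : I -> 'rV[R]_n -> R) (Psi : I -> R -> 'rV[R]_n -> 'rV[R]_n).
Variable Y0 : 'rV[R]_n -> 'rV[R]_n.

Definition run (l : seq I) (q : 'rV[R]_n) : 'rV[R]_n :=
  foldr (fun k y => Psi k (eta k q) y) (Y0 q) l.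

Hypothesis Psi0 : forall k x, Psi k 0 x = x.

Lemma run_id l q : (forall k, eta k q = 0) -> run l q = Y0 q.
Proof. by move=> H; elim: l => //= k l ->; rewrite H. Qed.

Lemma continuous_run l :
  (forall k (T : topologicalType) (e : T -> R) (Y : T -> 'rV[R]_n) (u : T),
      {for u, continuous e} -> {for u, continuous Y} ->
      {for u, continuous (fun v => Psi k (e v) (Y v))}) ->
  (forall k, continuous (eta k)) -> continuous Y0 -> continuous (run l).
Proof.
move=> cPsi ceta cY; elim: l => [//|k l IH] q /=.
exact: (cPsi k _ (eta k) (run l) q (ceta k q) (IH q)).
Qed.

(** The [k]-th motion does not increase the tilt for the slope [qs k]. The tilt
    for [q] differs from it by a linear form with coefficients [qs k - q], so a
    motion that is active at [q] increases it by at most [eps]. A motion run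
    for the full time brings it down to [-1]. *)
Lemma tilt_run l q : region (Y0 q) -> 0 <= eps ->
  (forall x, region x -> `|x| <= radius) ->
  (forall k, 0 <= eta k q <= 1) ->
  (forall k, eta k q != 0 -> n%:R * (`|q - qs k| * (2 * radius)) <= eps) ->
  (forall k t x, 0 <= t <= 1 -> region x ->
      region (Psi k t x) /\
      tilt f x0 (qs k) (Psi k t x) <= tilt f x0 (qs k) x) ->
  (forall k x, region x -> tilt f x0 q (Psi k 1 x) <= -1) ->
  let loss := (count (fun k => eta k q != 0) l)%:R * eps in
  [/\ region (run l q), tilt f x0 q (run l q) <= tilt f x0 q (Y0 q) + loss &
    forall k, k \in l -> eta k q = 1 -> tilt f x0 q (run l q) <= -1 + loss].
Proof.
move=> rY eps0 bnd eta01 close HPsi Hfar /=.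
elim: l => [|k l [IH1 IH2 IH3]] /=; first by rewrite mul0r addr0.
set x := run l q in IH1 IH2 IH3 *.
have [e0|e0] /= := eqVneq (eta k q) 0.
  rewrite e0 Psi0 add0n; split=> // k'; rewrite inE => /orP[/eqP ->|//].
    by rewrite e0 => /esym/eqP; rewrite oner_eq0.
  exact: IH3.
have [P1 P2] := HPsi k _ _ (eta01 k) IH1.
have P3 : tilt f x0 q (Psi k (eta k q) x) <= tilt f x0 q x + eps.
  set y := Psi _ _ _ in P1 P2 *.
  have E : tilt f x0 q y - tilt f x0 q x =
      tilt f x0 (qs k) y - tilt f x0 (qs k) x - dot (q - qs k) (y - x).
    by rewrite /tilt !dotBr !dotBl; ring.
  have : `|dot (q - qs k) (y - x)| <= eps.
    apply: le_trans (close k e0); apply: le_trans (ler_norm_dot _ _) _.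
    rewrite ler_wpM2l // ler_wpM2l //; apply: le_trans (ler_normB _ _) _.
    have := bnd _ P1; have := bnd _ IH1; lra.
  by rewrite ler_norml => /andP[]; move: E P2; lra.
rewrite natrD mulrDl mul1r; split=> //; first by move: P3 IH2; lra.
move=> k'; rewrite inE => /orP[/eqP ->|k'l] e1; last first.
  by have := IH3 _ k'l e1; move: P3; lra.
rewrite e1; apply: le_trans (Hfar k x IH1) _.
by rewrite lerDl addr_ge0 // mulr_ge0.
Qed.

End Run.

Section Grid.
Variables (R : realType) (n N : nat) (p : 'rV[R]_n) (r : R).
Hypotheses (r_gt0 : 0 < r) (N_ge4 : (4 <= N)%N).

Definition mesh : R := r / N%:R.

Definition node (k : {ffun 'I_n -> 'I_N.+1}) : 'rV[R]_n :=
  p + \row_i (mesh * (k i)%:R - r / 2).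

Definition bump (k : {ffun 'I_n -> 'I_N.+1}) (q : 'rV[R]_n) : R :=
  clamp01 (2 - `|q - node k| / mesh).

Let N_gt0 : 0 < N%:R :> R.
Proof. by rewrite ltr0n; exact: leq_trans N_ge4. Qed.

Lemma mesh_gt0 : 0 < mesh. Proof. by rewrite divr_gt0. Qed.

Lemma mesh_le : mesh <= r / 4.
Proof.
by rewrite /mesh ler_pM2l // lef_pV2 ?posrE // (ler_nat R 4).
Qed.

Lemma continuous_bump k : continuous (bump k).
Proof.
move=> q; apply: (@continuous_clamp01 R _
  (fun q : 'rV[R]_n => 2 - `|q - node k| / mesh)).
have cc (a : R) : {for q, continuous (fun _ : 'rV[R]_n => a)}.
  exact: cst_continuous.
have cn : {for q, continuous (fun y : 'rV[R]_n => `|y - node k|)}.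
  apply/continuous_distP => e e0; exists e => // y yq.
  apply: le_trans (ler_dist_dist _ _) _.
  by rewrite opprB addrA subrK.
exact: (cvgB (cc 2) (cvgM cn (cc mesh^-1))).
Qed.

Lemma node_near q : `|q - p| <= r / 2 -> exists k, `|q - node k| <= mesh.
Proof.
have m0 := mesh_gt0.
move=> qp; pose t i := (q 0 i - p 0 i + r / 2) / mesh.
have tN i : 0 <= t i <= N%:R.
  have := le_trans (coord_le_norm (q - p) i) qp.
  rewrite !mxE ler_norml => /andP[a1 a2].
  rewrite divr_ge0 ?(ltW m0) //=; last by move: a1; lra.
  rewrite ler_pdivrMr // /mesh [leRHS]mulrC divfK ?gt_eqF //; move: a2; lra.
exists [ffun i => inord (Num.trunc (t i))]; apply: norm_le_coord => [|i].
  exact: ltW.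
have /andP[t0 t1] := tN i; rewrite !mxE ffunE inordK; last first.
  rewrite ltnS -(ler_nat R); apply: le_trans t1.
  by have /andP[] := truncn_itv t0.
have /andP[] := truncn_itv t0; rewrite -natr1.
set m := (Num.trunc _)%:R => m1 m2.
have E : q 0 i = p 0 i - r / 2 + mesh * t i.
  have : t i * mesh = q 0 i - p 0 i + r / 2 by rewrite /t divfK ?gt_eqF.
  lra.
have e1 : mesh * m <= mesh * t i by rewrite ler_pM2l.
have e2 : mesh * t i < mesh * (m + 1) by rewrite ltr_pM2l.
by rewrite E ler_norml; lra.
Qed.

Lemma node_cube k : `|node k - p| <= r / 2.
Proof.
have m0 := mesh_gt0.
apply: norm_le_coord => [|i]; first by rewrite divr_ge0 // ltW.
rewrite !mxE addrAC subrr add0r.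
have h1 : 0 <= mesh * (k i)%:R by rewrite mulr_ge0 // ltW.
have h2 : mesh * (k i)%:R <= r.
  rewrite -[leRHS](@divfK _ N%:R) ?gt_eqF // ler_pM2l // ler_nat.
  by rewrite -ltnS ltn_ord.
by rewrite ler_norml; lra.
Qed.

Lemma bump_eq1 k q : `|q - node k| <= mesh -> bump k q = 1.
Proof.
have m0 := mesh_gt0; move=> H; apply: clamp01_eq1.
have : `|q - node k| / mesh <= 1 by rewrite ler_pdivrMr // mul1r.
lra.
Qed.

Lemma bump_neq0 k q : bump k q != 0 -> `|q - node k| < 2 * mesh.
Proof.
have m0 := mesh_gt0; apply: contraNT; rewrite -leNgt => H; apply/eqP.
apply: clamp01_eq0; have : 2 <= `|q - node k| / mesh by rewrite ler_pdivlMr.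
lra.
Qed.

(** Two nodes that are active at the same [q] differ by less than [4] in every
    index, so they are determined by their indices mod [4]. The bound does not
    depend on the mesh: this is what makes the total loss of the motions small.
    *)
Lemma count_bump q :
  (count (fun k => bump k q != 0%R) (enum {ffun 'I_n -> 'I_N.+1}) <= 4 ^ n)%N.
Proof.
have m0 := mesh_gt0.
pose g (k : {ffun 'I_n -> 'I_N.+1}) : {ffun 'I_n -> 'I_4} :=
  [ffun i => inord (k i %% 4)].
rewrite -size_filter.
have -> : (4 ^ n = #|{ffun 'I_n -> 'I_4}|)%N by rewrite card_ffun !card_ord.
rewrite -(size_map g); set l := [seq k <- _ | _].
suff /card_uniqP <- : uniq (map g l) by exact: max_card.
rewrite map_inj_in_uniq /l; first by rewrite filter_uniq // enum_uniq.
move=> k k'.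
rewrite !mem_filter => /andP[/bump_neq0 ak _] /andP[/bump_neq0 ak' _] gE.
apply/ffunP => i; apply: val_inj => /=.
have : `|node k - node k'| < 4 * mesh.
  rewrite -(subrKA q); apply: le_lt_trans (ler_normD _ _) _.
  by rewrite (distrC _ q); lra.
move/(le_lt_trans (coord_le_norm _ i)).
rewrite !mxE (_ : _ - _ = mesh * ((k i)%:R - (k' i)%:R)); last by ring.
rewrite normrM gtr0_norm // mulrC ltr_pM2r // => kk.
move/ffunP : gE => /(_ i); rewrite !ffunE => /(congr1 val) /=.
rewrite !inordK ?ltn_mod // => km.
have c1 : (k i < k' i + 4)%N.
  rewrite -(ltr_nat R) natrD; move: kk; rewrite ltr_norml => /andP[_]; lra.
have c2 : (k' i < k i + 4)%N.
  rewrite -(ltr_nat R) natrD; move: kk; rewrite ltr_norml => /andP[+ _]; lra.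
move: km c1 c2; move: (val (k i)) (val (k' i)) => a b; lia.
Qed.

End Grid.

(** * The gradient range is the closure of its interior *)

(** Along this section the linear part of the tilt is [- (rho / r) * dot v v]
    with [v = q - grad f x0], and the remainder of the first order expansion of
    [f] at [x0] is at most half of it away from the centre. *)
Lemma linear_section_tilt (R : realType) (n : nat) (f : 'rV[R]_n -> R)
    (x0 q : 'rV[R]_n) (r rho : R) :
  (0 < n)%N -> C1 f -> 0 < r -> 0 < rho ->
  (forall z, `|z - x0| <= rho -> `|grad f z - grad f x0| <= r / (4 * n%:R)) ->
  r / 2 <= `|q - grad f x0| <= r ->
  tilt f x0 q (x0 + (rho / r) *: (q - grad f x0)) <= - (rho * r / 8).
Proof.
move=> n_gt0 f_C1 r_gt0 rho_gt0 Hrho /andP[s1 s2].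
set v := q - grad f x0 in s1 s2 *; set a := rho / r.
have a_gt0 : 0 < a by rewrite divr_gt0.
have av : `|a *: v| = a * `|v| by rewrite normrZ gtr0_norm.
have av_le : `|a *: v| <= rho.
  by rewrite av /a mulrAC ler_pdivrMr // ler_wpM2l // ltW.
have := @C1_linear_approx R n f f_C1 x0 (a *: v) (grad f x0) (r / (4 * n%:R)).
move=> /(_ (fun z zx => Hrho z (le_trans zx av_le))).
rewrite (_ : n%:R * _ = r / 4 * (a * `|v|)); last first.
  by rewrite av; field; rewrite pnatr_eq0 -lt0n.
rewrite ler_norml => /andP[_ D].
rewrite /tilt (addrC x0 (a *: v)) addrK (addrC (a *: v)).
have -> : dot q (a *: v) = dot (grad f x0) (a *: v) + a * dot v v.
  by rewrite -dotZr -dotDl addrC subrK.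
have D2 := ler_wpM2l (ltW a_gt0) (dot_ge v).
have v2 : r / 2 * (r / 4) <= `|v| * (`|v| - r / 4).
  by apply: ler_pM; lra.
have := ler_wpM2l (ltW a_gt0) v2.
have -> : rho = a * r by rewrite /a divfK ?gt_eqF.
move: D D2; rewrite expr2; lra.
Qed.

(** Otherwise the linear section [Y0] could be deformed, near its centre only,
    to a continuous map [Y] with [tilt f x0 q (Y q) < 0 = tilt f x0 q x0] for
    all [q] in the cube: near the centre some motion runs for the full time,
    and elsewhere [Y0] has negative tilt already. Then [Y] avoids [x0] on the
    cube, although it is the linear section on the boundary and outside, which
    contradicts [exists_zero_of_id_outside_ball]. *)
Lemma grad_range_complement_not_dense (R : realType) (n : nat)
    (f : 'rV[R]_n -> R) (x0 : 'rV[R]_n) (r s : R) :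
  (0 < n)%N -> C1 f -> grad f x0 != 0 -> 0 < r ->
  8 * n%:R * r * `|grad f x0| <= dot (grad f x0) (grad f x0) ->
  (forall x, s <= `|x| -> f x = 0 /\ grad f x = 0) -> `|x0| <= s ->
  (forall c e, `|c - grad f x0| <= r / 2 -> 0 < e ->
     exists q, `|q - c| <= e /\ ~ grad_range f q) ->
  False.
Proof.
move=> n_gt0 f_C1; set p := grad f x0 => p0 r_gt0 r_small far x0s dense.
have s0 : 0 <= s by exact: le_trans x0s.
have nR : 0 < n%:R :> R by rewrite ltr0n.
have r4n : 0 < r / (4 * n%:R) by rewrite divr_gt0 // mulr_gt0.
have [d d0 Hd] :=
  (continuous_distP _ _).1 (continuous_grad f_C1 (x := x0)) _ r4n.
pose rho := Num.min d 1.
have rho0 : 0 < rho by rewrite lt_min d0 ltr01.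
have rho1 : rho <= 1 by rewrite ge_min lexx orbT.
have Hrho z : `|z - x0| <= rho -> `|grad f z - p| <= r / (4 * n%:R).
  by move=> zx; apply: Hd; apply: le_trans zx _; rewrite ge_min lexx.
pose B := radius f p x0 r s.
have bnd x : region f p x0 r s x -> `|x| <= B by exact: region_bounded.
have near x : `|x| <= s + 1 -> region f p x0 r s x.
  by apply: region_near => //; exact: ltW.
have B0 : 0 <= B.
  by apply: le_trans (bnd x0 _) => //; apply: near; move: x0s; lra.
(* [2 * mu] bounds both sources of negativity, so a total loss of [mu] can be
   afforded. *)
pose mu := Num.min 1 (rho * r / 8) / 2.
have mu0 : 0 < mu by rewrite divr_gt0 // lt_min ltr01 divr_gt0 // mulr_gt0.
have mu1 : 2 * mu <= 1 by rewrite /mu mulrC divfK // ge_min lexx.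
have mu2 : 2 * mu <= rho * r / 8 by rewrite /mu mulrC divfK // ge_min lexx orbT.
pose L : R := (4 ^ n)%:R * (n%:R * (3 * r * (2 * B))).
have [N N4 LN] : exists2 N, (4 <= N)%N & L <= mu * N%:R.
  exists (Num.trunc (L / mu)).+4 => //; rewrite mulrC -ler_pdivrMr //.
  apply: ltW; apply: lt_le_trans (truncnS_gt _) _.
  by rewrite ler_nat; exact: (leq_addl 3).
have N0 : 0 < N%:R :> R by rewrite ltr0n; exact: leq_trans N4.
pose h := mesh N r.
have h0 : 0 < h by exact: mesh_gt0.
have h4 : h <= r / 4 by exact: mesh_le.
pose eps := n%:R * (3 * h * (2 * B)).
have eps0 : 0 <= eps by rewrite !mulr_ge0 // ltW.
have eps_mu : (4 ^ n)%:R * eps <= mu.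
  rewrite (_ : _ * eps = L / N%:R); last first.
    by rewrite /eps /L /h /mesh; field; rewrite gt_eqF.
  by rewrite ler_pdivrMr.
pose I := {ffun 'I_n -> 'I_N.+1}.
have [qs Hqs] := choice (fun k : I => dense _ _ (node_cube p r_gt0 N4 k) h0).
have qs_p k : `|qs k - p| <= r.
  have := node_cube p r_gt0 N4 k; have [+ _] := Hqs k.
  have := ler_distD (node p r k) (qs k) p; lra.
have [Psi HPsi] := choice (fun k =>
  flow x0 n_gt0 f_C1 p0 (ltW r_gt0) r_small s0 far (qs_p k) (proj2 (Hqs k))).
pose Y0 q := x0 + (rho / r) *: (q - p).
pose Y := run (bump p r) Psi Y0 (enum I).
have cY0 : continuous Y0.
  rewrite (_ : Y0 = fun q => x0 - (rho / r) *: p + (rho / r) *: q).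
    exact: continuous_affine.
  by apply/funext => q; rewrite /Y0 scalerBr addrA addrAC.
have cY : continuous Y.
  apply: continuous_run => // k; first by have [_ H _ _] := HPsi k; exact: H.
  exact: continuous_bump.
have bump_cube (k : I) q : bump p r k q != 0 -> `|q - p| < r.
  move=> bk; have b := bump_neq0 r_gt0 N4 bk; have := node_cube p r_gt0 N4 k.
  have := ler_distD (node p r k) q p; move: b h4; rewrite -/h; lra.
have Yout q : r <= `|q - p| -> Y q = Y0 q.
  move=> rq; apply: run_id => [k x|k]; first by have [] := HPsi k.
  by apply/eqP/negPn/negP => /bump_cube; rewrite ltNge rq.
have le01 : 0 <= (1 : R) <= 1 by rewrite ler01 lexx.
have B2 : 0 <= 2 * B by rewrite mulr_ge0.
have close (k : I) q : bump p r k q != 0 -> `|q - qs k| <= 3 * h.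
  move=> bk; have b := bump_neq0 r_gt0 N4 bk; have [+ _] := Hqs k.
  rewrite distrC; have := ler_distD (node p r k) q (qs k).
  move: b; rewrite -/h; lra.
have Yneg q : `|q - p| <= r -> tilt f x0 q (Y q) < 0.
  move=> qr.
  have rY0 : region f p x0 r s (Y0 q).
    apply: near; apply: le_trans (ler_normD _ _) _; apply: lerD => //.
    rewrite normrZ gtr0_norm ?divr_gt0 // mulrAC ler_pdivrMr //.
    by apply: ler_pM => //; exact: ltW.
  have [_ Y1 Y2] := @tilt_run R n f x0 (region f p x0 r s) B eps _ qs
    (bump p r) Psi Y0 (fun k x => let: And4 H _ _ _ := HPsi k in H x)
    (enum I) q rY0 eps0 bnd (fun k => clamp01_itv _)
    (fun k bk => ler_wpM2l (ltW nR) (ler_wpM2r B2 (close k q bk)))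
    (fun k => let: And4 _ _ H _ := HPsi k in H)
    (fun k x rx => tilt_far n_gt0 p0 (ltW r_gt0) r_small s0 far qr
       (let: And4 _ _ H _ := HPsi k in (H 1 x le01 rx).1)
       (let: And4 _ _ _ H := HPsi k in H x rx)).
  have loss : (count (fun k => bump p r k q != 0) (enum I))%:R * eps <= mu.
    apply: le_trans eps_mu; rewrite ler_wpM2r // ler_nat.
    exact: count_bump.
  have [qr2|/ltW qr2] := leP `|q - p| (r / 2).
    have [k qk] := node_near r_gt0 N4 qr2.
    have := Y2 k (mem_enum _ _) (bump_eq1 r_gt0 N4 qk).
    rewrite -/Y; lra.
  have := @linear_section_tilt R n f x0 q r rho n_gt0 f_C1 r_gt0 rho0 Hrho.
  rewrite qr2 qr -/(Y0 q) => /(_ isT); move: Y1; rewrite -/(Y q); lra.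
(* In the coordinates centred at [p] and [x0], [F] is the identity outside the
   unit cube. *)
pose F t := rho^-1 *: (Y (p + r *: t) - x0).
have [||t Ft0] := @exists_zero_of_id_outside_ball R n F.
- rewrite (_ : F = (fun y => - (rho^-1 *: x0) + rho^-1 *: y) \o
      (Y \o (fun t => p + r *: t))).
    move=> t; apply: continuous_comp; last exact: continuous_affine.
    by apply: continuous_comp; [exact: continuous_affine | exact: cY].
  by apply/funext => t /=; rewrite /F scalerBr addrC.
- move=> t t1; rewrite /F Yout.
    rewrite /Y0 (addrC p) addrK scalerA (addrC x0) addrK scalerA.
    by rewrite divfK ?gt_eqF // mulVf ?gt_eqF // scale1r.
  by rewrite addrAC subrr add0r normrZ gtr0_norm // -[leLHS]mulr1 ler_pM2l.
have t1 : `|t| < 1.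
  rewrite ltNge; apply/negP => t1; move: (t1).
  have Ft : F t = t.
    rewrite /F Yout.
      rewrite /Y0 (addrC p) addrK scalerA (addrC x0) addrK scalerA.
      by rewrite divfK ?gt_eqF // mulVf ?gt_eqF // scale1r.
    by rewrite addrAC subrr add0r normrZ gtr0_norm // -[leLHS]mulr1 ler_pM2l.
  by rewrite -Ft Ft0 normr0 ler10.
set q := p + r *: t.
have qr : `|q - p| <= r.
  rewrite /q addrAC subrr add0r normrZ gtr0_norm // -[leRHS]mulr1.
  by rewrite ler_pM2l // ltW.
have Yx0 : Y q = x0.
  by move/eqP: Ft0; rewrite scaler_eq0 invr_eq0 gt_eqF //= subr_eq0 => /eqP.
by have := Yneg q qr; rewrite Yx0 /tilt !subrr dot0r subr0 ltxx.
Qed.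


Theorem theorem1p1 (R : realType) (n : nat) (hn : (1 <= n)%N)
  (f : 'rV[R]_n -> R) (f_C1 : C1 f) (f_neq0 : exists x, f x != 0)
  (f_supp : compact (supp f)) :
  grad_range f = closure (grad_range f)°.
Proof.
have [r0 far0] := vanish_far f_supp.
apply/seteqP; split=> [_ [x0 _ <-]|]; last first.
  rewrite [X in _ `<=` X](closure_id _).1.
    by apply: closure_subset; exact: interior_subset.
  by apply: (closed_grad_range hn f_C1) => x; exact: (far0 r0).
have int0 : nbhs (0 : 'rV[R]_n) (grad_range f).
  case: f_neq0 => x1; apply: (grad_range_nbhs0 hn f_C1) => x.
  exact: (far0 r0).
have [-> B /nbhs_singleton B0|p0] := eqVneq (grad f x0) 0.
  by exists 0; split.
apply: contrapT => /existsNP[B /not_implyP[/nbhs_ballP[e /= e0 eB] notB]].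
have np : 0 < `|grad f x0| by rewrite normr_gt0.
have nR : 0 < n%:R :> R by rewrite ltr0n.
pose r := Num.min e (dot (grad f x0) (grad f x0) / (8 * n%:R * `|grad f x0|)).
have r_gt0 : 0 < r.
  rewrite lt_min e0 divr_gt0 ?mulr_gt0 //.
  by apply: lt_le_trans (dot_ge _); rewrite exprn_gt0.
pose s := Num.max r0 `|x0|.
apply: (@grad_range_complement_not_dense R n f x0 r s) => //.
- rewrite mulrAC -ler_pdivlMl ?mulr_gt0 // mulrC.
  by rewrite ge_min lexx orbT.
- by move=> x; apply: far0; rewrite le_max lexx.
- by rewrite le_max lexx orbT.
move=> c d cp d0; apply: contrapT => all_in; apply: notB.
exists c; split; last first.
  apply: eB; rewrite -ball_normE /= distrC; apply: le_lt_trans cp _.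
  rewrite ltr_pdivrMr //; apply: le_lt_trans (_ : e < _).
    by rewrite ge_min lexx.
  by rewrite ltr_pMr // ltr1n.
apply: filterS (nbhsx_ballx c _ d0) => q; rewrite -ball_normE /= distrC => qc.
by apply: contrapT => Gq; apply: all_in; exists q; split=> //; exact: ltW.
Qed.
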